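(* A regular Hausdorff space $X$ has a base of countable order if and only if $\mathcal{F}(X)$ has a base of countable order.
   Context: $\mathcal{F}(X)$ is the set of nonempty finite subsets of $X$ with the Vietoris topology (base: $\langle U_1,\dots,U_k\rangle=\{A: A\subset\bigcup_i U_i,\ A\cap U_j\neq\emptyset\ \forall j\}$, $U_i$ open in $X$). A space $Y$ has a base of countable order (BCO) if there is a sequence $\{\mathcal{B}_n\}$ of bases of $Y$ such that whenever $x\in b_n\in\mathcal{B}_n$ for all $n$ and $\{b_n\}$ is decreasing, $\{b_n\}$ is a neighborhood base at $x$. *)

(* Defs.v *)
From HB Require Import structures.
From mathcomp Require Import all_boot all_order all_algebra.
From mathcomp Require Import all_classical all_reals all_analysis.
Set Implicit Arguments. Unset Strict Implicit. Unset Printing Implicit Defensive.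
Local Open Scope classical_set_scope.

Definition is_base (Y : Type) (opn : set (set Y)) (B : set (set Y)) : Prop :=
  B `<=` opn /\
  forall (W : set Y) (y : Y), opn W -> W y -> exists b, [/\ B b, b y & b `<=` W].

Definition has_BCO (Y : Type) (opn : set (set Y)) : Prop :=
  exists Bs : nat -> set (set Y),
    (forall n, is_base opn (Bs n)) /\
    forall (x : Y) (b : nat -> set Y),
      (forall n, Bs n (b n)) -> (forall n, b n x) ->
      (forall n, b n.+1 `<=` b n) ->
      forall W, opn W -> W x -> exists n, b n `<=` W.

Definition FinSub (X : Type) :=
  {A : set X | finite_set A /\ A !=set0}.

Definition vietoris_basic (X : Type) (k : nat) (U : 'I_k -> set X)
  : set (FinSub X) :=
  fun A => proj1_sig A `<=` \bigcup_(i in [set: 'I_k]) U i /\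
           forall i, proj1_sig A `&` U i !=set0.

Definition vietoris_open (X : topologicalType) : set (set (FinSub X)) :=
  fun W => forall A, W A ->
    exists (k : nat) (U : 'I_k -> set X),
      (forall i, open (U i)) /\ vietoris_basic U A /\ vietoris_basic U `<=` W.

(* Main.v *)
(* Call a sieve on a space a tree-like family of open covers, each member being
   covered by its children, such that every branch through a point x is a
   neighborhood base at x.  A decreasing sequence taken from a base of countable
   order is such a branch, and sieves, unlike bases of countable order, clearly
   pass to subspaces, hence from the hyperspace to the subspace of singletons.
   Conversely a sieve on X yields one on the hyperspace: its nodes of level n
   are the finite families of pairwise disjoint members of level n.  If A lies
   in a whole branch of this sieve, disjointness makes the members containing a
   given point of A a branch of the sieve on X.
   Finally a sieve yields a base of countable order: well-order the nodes, send
   each point y down the branch t_0(y), t_1(y), ... of least choices, and let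
   the n-th base consist of the open b contained in U(t_n(y)) for some y in b.
   For a decreasing sequence b_n witnessed by y_n, the node t_0(y_n) is
   nonincreasing in n, hence eventually constant; then so is t_1(y_n), etc.,
   and the limits form a branch. *)
Require Import Defs.
From mathcomp Require Import all_boot all_order all_algebra.
From mathcomp Require Import all_classical all_reals all_analysis.
From mathcomp Require Import wochoice.
Set Implicit Arguments. Unset Strict Implicit. Unset Printing Implicit Defensive.
Local Open Scope classical_set_scope.

(** * Well-ordered choices, and from sieves to bases of countable order *)

Lemma well_order_choice (T : Type) (t0 : T) :
  exists (le : T -> T -> Prop) (least : set T -> T),
    (forall s t, le s t -> le t s -> s = t) /\
    forall P : set T, P !=set0 ->
      P (least P) /\ forall t, P t -> le (least P) t.
Proof.
have [le wo_le] := well_ordering_principle {classic T}.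
have [least leastP] : {f : set T -> T & forall P : set T, P !=set0 ->
    P (f P) /\ forall t, P t -> le (f P) t}.
  apply: (@choice _ _ (fun (P : set T) z => P !=set0 ->
    P z /\ forall t, P t -> le z t)) => P.
  have [P0|nP0] := pselect (P !=set0); last by exists t0.
  have [|z [[Pz zP] _]] := wo_le (fun t : {classic T} => `[< P t >]).
    by case: P0 => t Pt; exists t; exact/asboolP.
  exists z => _; split; first exact/asboolP.
  by move=> t Pt; apply: zP; exact/asboolP.
exists (fun s t => le s t), least; split=> // s t st ts.
have wo_chain_le : wo_chain le (mem {: {classic T}}) by exact: withinW.
by apply: (wo_chain_antisymmetric wo_chain_le) => //; rewrite st ts.
Qed.

(** Both directions of the theorem end here. The type [T] of nodes is abstract because the nodes are
    families of open sets of X in one direction and open sets of the hyperspace in the other. *)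
Lemma has_BCO_sieve (Y T : Type) (opn : set (set Y)) (level : nat -> set T)
    (child : T -> T -> Prop) (U : T -> set Y) :
  (forall V W, opn V -> opn W -> opn (V `&` W)) ->
  (forall n t, level n t -> opn (U t)) ->
  (forall y, exists2 t, level 0 t & U t y) ->
  (forall n t y, level n t -> U t y ->
     exists s, [/\ level n.+1 s, child t s & U s y]) ->
  (forall t s, child t s -> U s `<=` U t) ->
  (forall (t : nat -> T) x, (forall n, level n (t n)) ->
     (forall n, child (t n) (t n.+1)) -> (forall n, U (t n) x) ->
     forall W, opn W -> W x -> exists n, U (t n) `<=` W) ->
  has_BCO opn.
Proof.
move=> opnI opnU cover0 coverS childU branch.
(* If Y is empty there may be no node to serve as default for [least], but then any bases do. *)
have [[y0 _]|Y0] := pselect (exists y : Y, True); last first.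
  exists (fun=> opn); split=> [_|x]; last by case: Y0; exists x.
  by split=> [//|W y opnW Wy]; exists W; split.
have [t0 _ _] := cover0 y0.
have [le [least [le_anti leastP]]] := well_order_choice t0.
pose tn y := fix tn n := if n is m.+1
  then least [set s | [/\ level m.+1 s, child (tn m) s & U s y]]
  else least [set s | level 0 s /\ U s y].
have tn0P y : [/\ level 0 (tn y 0), U (tn y 0) y &
    forall s, level 0 s -> U s y -> le (tn y 0) s].
  have [|[l0 U0] least0] := leastP [set s | level 0 s /\ U s y].
    by have [s] := cover0 y; exists s.
  by split=> // s ls Us; exact: least0.
have tnU y n : level n (tn y n) /\ U (tn y n) y.
  elim: n => [|n [ln Un]]; first by have [] := tn0P y.
  by have [|[]] :=
    leastP [set s | [/\ level n.+1 s, child (tn y n) s & U s y]];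
    first exact: coverS.
have tnSP y n : child (tn y n) (tn y n.+1) /\
    forall s, level n.+1 s -> child (tn y n) s -> U s y -> le (tn y n.+1) s.
  have [ln Un] := tnU y n.
  have [|[_ cS _] leastS] :=
    leastP [set s | [/\ level n.+1 s, child (tn y n) s & U s y]].
    exact: coverS.
  by split=> // s ls cs Us; exact: leastS.
have tn_sub y m n : (m <= n)%N -> U (tn y n) `<=` U (tn y m).
  elim: n => [|n IHn]; first by rewrite leqn0 => /eqP ->.
  rewrite leq_eqVlt => /predU1P[-> //|/IHn]; apply: subset_trans.
  by apply: childU; have [] := tnSP y n.
(* The least value on the tail is attained, and antisymmetry prevents any later change. *)
have noninc_stable (f : nat -> T) N0 :
    (forall m n, (N0 <= n)%N -> (n <= m)%N -> le (f m) (f n)) ->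
    exists2 N, (N0 <= N)%N & forall n, (N <= n)%N -> f n = f N.
  move=> f_le; have [|[N N0N fN] fmin] := leastP (f @` [set n | (N0 <= n)%N]).
    by exists (f N0), N0 => /=.
  exists N => // n Nn; apply: le_anti; first exact: f_le.
  by rewrite {1}fN; apply: fmin; exists n => //=; exact: leq_trans Nn.
exists (fun n => [set b | opn b /\ exists2 y, b y & b `<=` U (tn y n)]).
split=> [n|x b bB bx bS W opnW Wx].
  split=> [b []//|W y opnW Wy]; have [ln Un] := tnU y n.
  exists (W `&` U (tn y n)); split=> //.
  split; first by apply: opnI => //; exact: (opnU n).
  by exists y => //; exact: subIsetr.
have b_sub m n : (m <= n)%N -> b n `<=` b m.
  elim: n => [|n IHn]; first by rewrite leqn0 => /eqP ->.
  rewrite leq_eqVlt => /predU1P[-> //|/IHn]; apply: subset_trans.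
  exact: bS.
have [y yP] : {y : nat -> Y & forall n, b n (y n) /\ b n `<=` U (tn (y n) n)}.
  by apply: (@choice _ _ (fun n y => b n y /\ b n `<=` U (tn y n))) => n;
    have [_ [y]] := bB n; exists y.
(* Since [y m] lies in this set, the node [tn (y n) k] competes in the least choice that defines
   [tn (y m) k], as soon as both have the same parent. *)
have y_sub k m n : (k <= n)%N -> (n <= m)%N -> U (tn (y n) k) (y m).
  move=> kn nm; apply: (tn_sub _ _ _ kn); apply: (proj2 (yP n)).
  by apply: (b_sub _ _ nm); exact: (proj1 (yP m)).
have stable k : exists s, exists2 N, (k <= N)%N &
    forall n, (N <= n)%N -> tn (y n) k = s.
  elim: k => [|k [s [N kN sN]]].
    have [m n _ nm|N _ NP] := noninc_stable (fun n => tn (y n) 0) 0.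
      have [_ _] := tn0P (y m); apply; last exact: y_sub.
      by have [] := tn0P (y n).
    by exists (tn (y N) 0), N.
  (* Past N the parent is the constant [s]; starting at [N.+1] also gives [k.+1 <= n], as [y_sub]
     requires. *)
  have [m n kn nm|M kM MP] := noninc_stable (fun n => tn (y n) k.+1) N.+1.
    have [_] := tnSP (y m) k; apply; first by have [] := tnU (y n) k.+1.
      rewrite (sN m) -?(sN n); first by have [] := tnSP (y n) k.
        exact: ltnW.
      exact: leq_trans (ltnW kn) nm.
    by apply: y_sub => //; exact: leq_trans kn.
  by exists (tn (y M) k.+1), M => //; exact: leq_trans kM.
have [s sP] := choice stable.
have in_s k n : exists2 m, (n <= m)%N & tn (y m) k = s k /\ (k <= m)%N.
  have [N kN NP] := sP k; exists (maxn n N); first exact: leq_maxl.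
  by split; [apply: NP; exact: leq_maxr|exact: leq_trans kN (leq_maxr _ _)].
(* This puts x in every [U (s k)] and carries the conclusion from the limit branch back to [b]. *)
have b_s k : exists n, b n `<=` U (s k).
  have [n _ [<- kn]] := in_s k 0; exists n.
  by apply: subset_trans (tn_sub _ _ _ kn); exact: (proj2 (yP n)).
have [k|k|k|k kW] := branch s x _ _ _ W opnW Wx.
- by have [n _ [<- _]] := in_s k 0; have [] := tnU (y n) k.
- have [N _ NP] := sP k; have [n Nn [<- _]] := in_s k.+1 N.
  by rewrite -(NP n Nn); have [] := tnSP (y n) k.
- by have [n bn] := b_s k; exact: bn.
- by have [n bn] := b_s k; exists n; exact: subset_trans kW.
Qed.

(** * Finite sets in a Hausdorff space, and the Vietoris topology *)

Lemma finite_bigcap_open (X : topologicalType) (I : choiceType) (A : set I)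
    (O : I -> set X) :
  finite_set A -> (forall i, open (O i)) -> open (\bigcap_(i in A) O i).
Proof.
move=> /finite_seqP[s ->] oO; rewrite bigcap_seq.
by apply: big_ind => //; [exact: openT|exact: openI].
Qed.

Lemma finite_nat_bound (I : eqType) (A : set I) (f : I -> nat) :
  finite_set A -> exists N, forall i, A i -> (f i <= N)%N.
Proof.
move=> /finite_seqP[s ->]; exists (\max_(i <- s) f i) => i si.
exact: leq_bigmax_seq.
Qed.

Lemma hausdorff_finite_separation (X : topologicalType) (A : set X) :
  hausdorff_space X -> finite_set A ->
  exists G : X -> set X, (forall x, open (G x) /\ G x x) /\
    forall x y z, A x -> A y -> G x z -> G y z -> x = y.
Proof.
rewrite open_hausdorff => hX finA.
have [sep sepP] : {sep : X * X -> set X * set X & forall p, p.1 <> p.2 ->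
    [/\ (sep p).1 p.1, (sep p).2 p.2, open (sep p).1, open (sep p).2 &
        (sep p).1 `&` (sep p).2 = set0]}.
  apply: (@choice _ _ (fun p (sep : set X * set X) => p.1 <> p.2 ->
    [/\ sep.1 p.1, sep.2 p.2, open sep.1, open sep.2 & sep.1 `&` sep.2 = set0])) => -[x y].
  have [->|/hX[B [xB yB] [oB1 oB2 /eqP B0]]] := eqVneq x y.
    by exists (set0, set0).
  by exists B => _; split=> //; exact: set_mem.
(* The chosen separation need not be symmetric in x and y. Using both orders puts [V x y] and
   [V y x] on opposite sides of [sep (x, y)]. *)
pose V x y := if x == y then setT else (sep (x, y)).1 `&` (sep (y, x)).2.
exists (fun x => \bigcap_(y in A) V x y); split=> [x|x y z Ax Ay Gx Gy].
  split.
    apply: finite_bigcap_open => // y; rewrite /V.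
    case: eqP => xy; first exact: openT.
    have [_ _ o1 _ _] := sepP (x, y) xy.
    have [|_ _ _ o2 _] := sepP (y, x); first by move=> yx; exact: xy.
    exact: openI.
  move=> y _; rewrite /V; case: eqP => // xy.
  have [x1 _ _ _ _] := sepP (x, y) xy.
  by have [|_ x2 _ _ _] := sepP (y, x); first by move=> yx; exact: xy.
apply: contrapT => xy; have := Gx y Ay; have := Gy x Ax; rewrite /V.
case: eqP => [yx|_]; first by have := xy (esym yx).
case: eqP => // _ [_ z2] [z1 _].
have [_ _ _ _ O0] := sepP (x, y) xy.
by have : set0 z by rewrite -O0; split.
Qed.

(** Indexing by the family itself makes finite families usable as sieve nodes, with no enumeration
    to carry along. *)
Definition vietoris_family (X : Type) (F : set (set X)) : set (FinSub X) :=
  [set A | proj1_sig A `<=` \bigcup_(t in F) t /\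
           forall t, F t -> proj1_sig A `&` t !=set0].

Lemma vietoris_family_open (X : topologicalType) (F : set (set X)) :
  finite_set F -> (forall t, F t -> open t) ->
  vietoris_open (vietoris_family F).
Proof.
move=> /(@finite_seqP {classic (set X)})[s ->] oF A [AF FA].
exists (size s), (fun i => nth set0 s i); split=> [i|].
  by apply: oF; exact: (@mem_nth {classic (set X)}).
split.
  split=> [x /AF[t /= ts tx]|i]; last first.
    by apply: FA; exact: (@mem_nth {classic (set X)}).
  have ts' : (index (t : {classic (set X)}) s < size s)%N by rewrite index_mem.
  by exists (Ordinal ts') => //=; rewrite (@nth_index {classic (set X)}).
move=> B [Bs sB]; split=> [x /Bs[i _ xi]|t ts].
  by exists (nth set0 s i) => //; exact: (@mem_nth {classic (set X)}).
have ts' : (index (t : {classic (set X)}) s < size s)%N by rewrite index_mem.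
by have := sB (Ordinal ts'); rewrite /= (@nth_index {classic (set X)}).
Qed.

Lemma vietoris_openI (X : topologicalType) (V W : set (FinSub X)) :
  vietoris_open V -> vietoris_open W -> vietoris_open (V `&` W).
Proof.
move=> oV oW A [/oV[k [P [oP [[AP PA] PV]]]] /oW[l [Q [oQ [[AQ QA] QW]]]]].
pose UP := \bigcup_(i in [set: 'I_k]) P i.
pose UQ := \bigcup_(j in [set: 'I_l]) Q j.
have oUP : open UP by exact: bigcup_open.
have oUQ : open UQ by exact: bigcup_open.
(* Cutting each P_i by the union of the Q_j, and vice versa, gives a basic set inside both given
   ones. *)
pose F := range (fun i => P i `&` UQ) `|` range (fun j => Q j `&` UP).
have [|t||m [U [oU [UA UF]]]] := @vietoris_family_open X F _ _ A.
- by rewrite finite_setU; split; apply: finite_image; exact: finite_finset.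
- by case=> -[i _ <-]; exact: openI.
- split=> [x Ax|_ [[i _ <-]|[j _ <-]]].
  + have [i _ Pix] := AP x Ax; exists (P i `&` UQ); first by left; exists i.
    by split=> //; exact: AQ.
  + by have [x [Ax Pix]] := PA i; exists x; split=> //; split=> //; exact: AQ.
  + by have [x [Ax Qjx]] := QA j; exists x; split=> //; split=> //; exact: AP.
exists m, U; split=> //; split=> // B /UF[BF FB]; split.
  apply: PV; split=> [x /BF[_ [[i _ <-]|[j _ <-]] [? ?]]|i] //; first by exists i.
  by have [|x [Bx [? _]]] := FB (P i `&` UQ); [left; exists i|exists x].
apply: QW; split=> [x /BF[_ [[i _ <-]|[j _ <-]] [? ?]]|j] //; first by exists j.
by have [|x [Bx [? _]]] := FB (Q j `&` UP); [right; exists j|exists x].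
Qed.

(** * From the space to its hyperspace *)

Lemma has_BCO_vietoris (X : topologicalType) :
  hausdorff_space X -> has_BCO (@open X) -> has_BCO (@vietoris_open X).
Proof.
move=> hX [Bs [baseB BCO]].
have openB n b : Bs n b -> open b by have [+ _] := baseB n; apply.
pose disj (F : set (set X)) :=
  forall s t x, F s -> F t -> s x -> t x -> s = t.
(* The two clauses carry over, respectively, the covering and the meeting condition from [F'] to
   [F]. *)
pose refines (F F' : set (set X)) :=
  (forall s, F' s -> exists2 t, F t & s `<=` t) /\
  (forall t, F t -> exists2 s, F' s & s `<=` t).
have shrink n (A : FinSub X) (V : X -> set X) :
    (forall x, sval A x -> open (V x) /\ V x x) ->
    exists t : X -> set X, (forall x, sval A x -> t x x /\ t x `<=` V x) /\
      [/\ finite_set (t @` sval A), t @` sval A `<=` Bs n,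
          disj (t @` sval A) & vietoris_family (t @` sval A) A].
  move=> oV; have finA := (proj1 (svalP A)).
  have [G [GP Gdisj]] := hausdorff_finite_separation hX finA.
  have [t tP] : {t : X -> set X & forall x, sval A x ->
      [/\ Bs n (t x), t x x & t x `<=` G x `&` V x]}.
    apply: (@choice _ _ (fun x t => sval A x ->
      [/\ Bs n t, t x & t `<=` G x `&` V x])) => x.
    have [Ax|nAx] := pselect (sval A x); last by exists set0.
    have [oG Gx] := GP x; have [oVx Vx] := oV x Ax.
    have [_ /(_ (G x `&` V x) x)[||b]] := baseB n; first exact: openI.
      by [].
    by exists b.
  exists t; split=> [x /tP[_ tx tGV]|].
    by split=> // z /tGV[].
  split.
  - exact: finite_image.
  - by move=> _ [x /tP[] ? _ _ <-].
  - move=> _ _ z [x Ax <-] [y Ay <-] xz yz.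
    have [_ _ /(_ _ xz)[Gxz _]] := tP _ Ax.
    have [_ _ /(_ _ yz)[Gyz _]] := tP _ Ay.
    by rewrite (Gdisj x y z).
  - split=> [x Ax|_ [x Ax <-]]; have [_ tx _] := tP x Ax.
      by exists (t x) => //; exists x.
    by exists x.
apply: (@has_BCO_sieve _ _ _
  (fun n => [set F | [/\ finite_set F, F `<=` Bs n & disj F]])
  refines (@vietoris_family X)).
- exact: vietoris_openI.
- move=> n F [finF FB _]; apply: vietoris_family_open => // t /FB.
  exact: openB.
- move=> A; have [|t [_ [? ? ? ?]]] := @shrink 0 A (fun=> setT).
    by move=> x _; split=> //; exact: openT.
  by exists (t @` sval A).
- move=> n F A [_ FB Fdisj] [AF FA].
  have [V VP] : {V : X -> set X & forall x, sval A x -> F (V x) /\ V x x}.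
    apply: (@choice _ _ (fun x V => sval A x -> F V /\ V x)) => x.
    have [/AF[V FV Vx]|nAx] := pselect (sval A x); first by exists V.
    by exists set0.
  have [x /VP[/FB/openB ? ?]//|t [tV [finF' F'B F'disj F'A]]] :=
    @shrink n.+1 A V.
  exists (t @` sval A); split=> //; split=> [_ [x Ax <-]|s Fs].
    by exists (V x); [have [] := VP x Ax|have [] := tV x Ax].
  (* Each s in F meets A at some x; disjointness forces [V x] to be s, so [t x] shrinks s. *)
  have [x [Ax sx]] := FA s Fs; exists (t x); first by exists x.
  have [FV Vx] := VP x Ax; have [_] := tV x Ax.
  by rewrite (Fdisj _ _ x FV Fs Vx sx).
- move=> F F' [F'F FF'] A [AF' F'A]; split=> [x /AF'[s /F'F[t Ft st] sx]|t Ft].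
    by exists t => //; exact: st.
  have [s /F'A[x [Ax sx]] st] := FF' t Ft.
  by exists x; split=> //; exact: st.
move=> F A levF refF FA W oW WA.
have finA := proj1 (svalP A).
have [k [P [oP [[AP PA] PW]]]] := oW A WA.
have near_pt x : exists n, sval A x ->
    forall t, F n t -> t x -> t `<=` \bigcap_(i in [set i | P i x]) P i.
  have [Ax|nAx] := pselect (sval A x); last by exists 0.
  have [t tP] : {t : nat -> set X & forall n, F n (t n) /\ t n x}.
    apply: (@choice _ _ (fun n t => F n t /\ t x)) => n.
    by have [/(_ x Ax)[t]] := FA n; exists t.
  have oPx : open (\bigcap_(i in [set i | P i x]) P i).
    apply: finite_bigcap_open => //; exact: finite_finset.
  have [n|n|n|//|n tn] := BCO x t _ _ _ _ oPx.
  - by have [_ + _] := levF n; apply; have [] := tP n.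
  - by have [] := tP n.
  (* The parent of [t n.+1] contains x, hence is [t n] by disjointness: the sequence decreases. *)
  - have [FS tS] := tP n.+1; have [Fn tn] := tP n.
    have [/(_ _ FS)[s Fs tSs] _] := refF n.
    have [_ _ /(_ s (t n) x Fs Fn)] := levF n.
    by move=> <- //; exact: tSs.
  exists n => _ s Fs sx; have [Fn tnx] := tP n.
  by have [_ _ /(_ s (t n) x Fs Fn sx tnx) ->] := levF n.
have [nx nxP] := choice near_pt.
(* A is finite, so one level N serves all its points; [F_desc] transfers the inclusions down to
   it. *)
have [N NP] := finite_nat_bound nx finA.
have F_desc m n s : (m <= n)%N -> F n s -> exists2 t, F m t & s `<=` t.
  elim: n s => [|n IHn] s; first by rewrite leqn0 => /eqP -> Fs; exists s.
  rewrite leq_eqVlt => /predU1P[-> Fs|mn]; first by exists s.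
  have [F'F _] := refF n; move=> /F'F[t /(IHn _ mn)[u Fu tu] st].
  by exists u => //; exact: subset_trans tu.
have FN x s : sval A x -> F N s -> s x ->
    s `<=` \bigcap_(i in [set i | P i x]) P i.
  move=> Ax Fs sx; have [t Ft st] := F_desc _ _ _ (NP x Ax) Fs.
  by apply: subset_trans (st) _; apply: (nxP x Ax t Ft); exact: st.
have [AFN FNA] := FA N.
(* Members of [F N] link A and B: each meets both sets and lies in every P_i containing one of its
   points of A. *)
exists N => B [BF FB]; apply: PW; split=> [y /BF[s Fs sy]|i].
  have [x [Ax sx]] := FNA s Fs; have [i _ Pix] := AP x Ax.
  by exists i => //; exact: (FN x s).
have [x [Ax Pix]] := PA i; have [s Fs sx] := AFN x Ax.
have [y [By sy]] := FB s Fs; exists y; split=> //.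
exact: (FN x s).
Qed.

(** * From the hyperspace to the space, through singletons *)

Definition finsub1 (X : Type) (x : X) : FinSub X :=
  exist _ [set x] (conj (finite_set1 x) (ex_intro _ x erefl)).

(** Decreasing traces on the singletons may come from sets that do not decrease in the hyperspace;
    taking inclusion there as the child relation of a sieve avoids this. *)
Lemma has_BCO_of_vietoris (X : topologicalType) :
  has_BCO (@vietoris_open X) -> has_BCO (@open X).
Proof.
move=> [Bs [baseB BCO]].
have vopenT : vietoris_open [set: FinSub X].
  move=> A _; exists 1, (fun=> setT); split=> [i|]; first exact: openT.
  split=> //; split=> [x _|i]; first by exists ord0.
  by have [_ [x Ax]] := svalP A; exists x.
apply: (@has_BCO_sieve _ _ _ Bs (fun b c => c `<=` b)
  (fun b => [set x | b (finsub1 x)])).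
- exact: openI.
- move=> n b Bb; have [/(_ b Bb) ob _] := baseB n.
  rewrite openE => x /ob[k [U [oU [[xU Ux] Ub]]]].
  (* Each U_i meets the singleton of x, so x lies in all of them; any y in their intersection has
     its singleton in the same basic set. *)
  have oUx : open (\bigcap_(i in [set: 'I_k]) U i).
    by apply: finite_bigcap_open => //; exact: finite_finset.
  apply: (filterS _ (open_nbhs_nbhs (conj oUx _))).
    move=> y Uy; apply: Ub; split=> [_ ->|i].
      have [i _ _] := xU x erefl; exists i => //.
      exact: Uy.
    by exists y; split=> //; exact: Uy.
  by move=> i _; have [_ [-> ]] := Ux i.
- by move=> x; have [_ /(_ setT (finsub1 x) vopenT I)[b []]] := baseB 0; exists b.
- move=> n b x Bb bx; have [/(_ b Bb) ob _] := baseB n.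
  have [_ /(_ b (finsub1 x) ob bx)[c [Bc cx cb]]] := baseB n.+1.
  by exists c.
- by move=> b c cb x; exact: cb.
move=> b x Bb bS bx W oW Wx.
have [||n bn] := BCO (finsub1 x) b Bb bx bS (vietoris_family [set W]).
- by apply: vietoris_family_open => // _ ->.
- by split=> [_ ->|_ ->]; [exists W|exists x].
exists n => y /bn[/(_ y erefl)[_ -> ]]; exact.
Qed.

Theorem theorem4p1 (X : topologicalType) :
  hausdorff_space X -> regular_space X ->
  (has_BCO (@open X) <-> has_BCO (@vietoris_open X)).
Proof.
move=> hX _; split; first exact: has_BCO_vietoris.
exact: has_BCO_of_vietoris.
Qed.
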